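(* Let $\overline{\bm{p}}_{sa}\in\Delta_S$ with $\overline{\bm{p}}_{sa}>\bm{0}$, let $\bm{b}\in\mathbb{R}^S_+$ and $\beta\in\mathbb{R}_+$ with $\bm{b}^\top\overline{\bm{p}}_{sa}>\beta$, and consider the projection problem $$\mathfrak{P}(\overline{\bm{p}}_{sa};\bm{b},\beta)=\min\left\{\sum_{s'\in\mathcal{S}}\overline{p}_{sas'}\,\phi\!\left(\frac{p_{sas'}}{\overline{p}_{sas'}}\right) : \bm{b}^\top\bm{p}_{sa}\le\beta,\ \bm{p}_{sa}\in\Delta_S\right\}$$ for the Kullback-Leibler divergence $\phi(t)=t\log t-t+1$. If $\beta\ge\min\{\bm{b}\}+\omega$ for some $\omega>0$, then the projection problem can be solved to any $\delta$-accuracy, $\delta>0$, in time $$\mathcal{O}\left(S\cdot\log\left[\frac{\max\{\bm{b}\}\cdot\log(\min\{\overline{\bm{p}}_{sa}\}^{-1})}{\delta\,\omega}\right]\right).$$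
   Context: $\mathcal{S}=\{1,\dots,S\}$; $\Delta_S=\{\bm{p}\in\mathbb{R}^S_+ : \sum_{s'}p_{s'}=1\}$; the subscript $sa$ is a fixed index (state-action pair). $\min\{\bm{x}\}$ and $\max\{\bm{x}\}$ denote the smallest and largest component of a vector $\bm{x}$. Convention $0\log 0=0$. The projection problem is solved to $\delta$-accuracy by any pair $(\underline{d},\overline{d})\in\mathbb{R}^2$ with $\mathfrak{P}(\overline{\bm{p}}_{sa};\bm{b},\beta)\in[\underline{d},\overline{d}]$ and $\overline{d}-\underline{d}\le\delta$. Running time counts elementary operations on real numbers (arithmetic, comparisons, evaluations of elementary functions such as $\exp$ and $\log$), each at unit cost. *)

(* Defs.v *)
From mathcomp Require Import all_boot all_order all_algebra.
From mathcomp Require Import all_classical all_reals all_analysis.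

Set Implicit Arguments.
Unset Strict Implicit.
Unset Printing Implicit Defensive.

Import Order.TTheory GRing.Theory Num.Theory.
Local Open Scope classical_set_scope.
Local Open Scope ring_scope.

Section Projection.
Variables (R : realType) (n : nat).
(* Vectors of R^S, S >= 1, are functions on 'I_S with S = n.+1. *)
Implicit Types (p pbar b x : 'I_n.+1 -> R) (beta delta : R).

Definition simplex : set ('I_n.+1 -> R) :=
  [set p | (forall i, 0 <= p i) /\ \sum_i p i = 1].

Definition dotv x p : R := \sum_i x i * p i.

Definition minv x : R := \big[Num.min/x ord0]_i x i.
Definition maxv x : R := \big[Num.max/x ord0]_i x i.

(* At t = 0 this is 1: the convention 0 log 0 = 0 holds since 0 * _ = 0. *)
Definition phiKL (t : R) : R := t * ln t - t + 1.

Definition divKL pbar p : R := \sum_i pbar i * phiKL (p i / pbar i).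

Definition feasible b beta : set ('I_n.+1 -> R) :=
  [set p | dotv b p <= beta /\ simplex p].

(* v is the minimum, attained, of the projection problem. *)
Definition projection_value pbar b beta (v : R) : Prop :=
  let values := [set divKL pbar p | p in feasible b beta] in
  values v /\ lbound values v.

Definition delta_solution pbar b beta delta (dlo dhi : R) : Prop :=
  (exists2 v, projection_value pbar b beta v & dlo <= v <= dhi) /\
  dhi - dlo <= delta.

End Projection.

(* A real random-access machine, programmed in a structured language.  It has *)
(* real registers, index (natural number) registers, and arrays of reals that *)
(* can only be addressed through index registers.  The sole literals are      *)
(* integers, so a program cannot hide real-valued information, and a single   *)
(* program treats inputs of every size.                                       *)
Inductive instr : Type :=
| RConst (r : nat) (z : int)
| RCopy (r s : nat)
| RAdd (r s t : nat)
| RSub (r s t : nat)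
| RMul (r s t : nat)
| RDiv (r s t : nat)
| RExp (r s : nat)
| RLog (r s : nat)
| RLoad (r a i : nat)
| RStore (a i r : nat)
| IConst (i k : nat)
| ICopy (i j : nat)
| ISucc (i : nat).

Inductive test : Type :=
| RLe (r s : nat)
| RLt (r s : nat)
| ILt (i j : nat).

Inductive prog : Type :=
| Skip
| Instr (o : instr)
| Seq (c d : prog)
| If (t : test) (c d : prog)
| While (t : test) (c : prog).

Section Semantics.
Variable R : realType.

Record state : Type := State {
  rreg : nat -> R;
  ireg : nat -> nat;
  arr : nat -> nat -> R }.

Definition upd (T : Type) (f : nat -> T) (k : nat) (x : T) : nat -> T :=
  fun j => if j == k then x else f j.

Definition set_rreg (s : state) r x := State (upd (rreg s) r x) (ireg s) (arr s).
Definition set_ireg (s : state) i k := State (rreg s) (upd (ireg s) i k) (arr s).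
Definition set_arr (s : state) a k x :=
  State (rreg s) (ireg s) (upd (arr s) a (upd (arr s a) k x)).

(* Division by 0 and logarithms of nonpositive numbers block the machine, so  *)
(* the default values that the library assigns to them are never used.        *)
Definition instr_defined (o : instr) (s : state) : bool :=
  match o with
  | RDiv _ _ v => rreg s v != 0
  | RLog _ u => 0 < rreg s u
  | _ => true
  end.

Definition exec_instr (o : instr) (s : state) : state :=
  match o with
  | RConst r z => set_rreg s r z%:~R
  | RCopy r u => set_rreg s r (rreg s u)
  | RAdd r u v => set_rreg s r (rreg s u + rreg s v)
  | RSub r u v => set_rreg s r (rreg s u - rreg s v)
  | RMul r u v => set_rreg s r (rreg s u * rreg s v)
  | RDiv r u v => set_rreg s r (rreg s u / rreg s v)
  | RExp r u => set_rreg s r (expR (rreg s u))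
  | RLog r u => set_rreg s r (ln (rreg s u))
  | RLoad r a i => set_rreg s r (arr s a (ireg s i))
  | RStore a i r => set_arr s a (ireg s i) (rreg s r)
  | IConst i k => set_ireg s i k
  | ICopy i j => set_ireg s i (ireg s j)
  | ISucc i => set_ireg s i (ireg s i).+1
  end.

Definition eval_test (t : test) (s : state) : bool :=
  match t with
  | RLe u v => rreg s u <= rreg s v
  | RLt u v => rreg s u < rreg s v
  | ILt i j => (ireg s i < ireg s j)%N
  end.

(* exec c s s' T: started in s, the program c halts in s' after T operations; *)
(* every instruction (on reals or on indices) and every test costs one.       *)
Inductive exec : prog -> state -> state -> nat -> Prop :=
| ExecSkip s : exec Skip s s 0
| ExecInstr o s : instr_defined o s -> exec (Instr o) s (exec_instr o s) 1
| ExecSeq c d s s1 s2 T1 T2 :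
    exec c s s1 T1 -> exec d s1 s2 T2 -> exec (Seq c d) s s2 (T1 + T2)
| ExecIfTrue t c d s s1 T :
    eval_test t s -> exec c s s1 T -> exec (If t c d) s s1 T.+1
| ExecIfFalse t c d s s1 T :
    ~~ eval_test t s -> exec d s s1 T -> exec (If t c d) s s1 T.+1
| ExecWhileTrue t c s s1 s2 T1 T2 :
    eval_test t s -> exec c s s1 T1 -> exec (While t c) s1 s2 T2 ->
    exec (While t c) s s2 (T1 + T2).+1
| ExecWhileFalse t c s : ~~ eval_test t s -> exec (While t c) s s 1.

Lemma exec_det c s s1 s2 T1 T2 :
  exec c s s1 T1 -> exec c s s2 T2 -> s1 = s2 /\ T1 = T2.
Proof.
move=> e1; elim: e1 s2 T2 => {c s s1 T1}.
- by move=> s s2 T2 e; inversion e.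
- by move=> o s _ s2 T2 e; inversion e.
- move=> c d s s1 s2 T1 T2 _ IH1 _ IH2 s3 T3 e.
  inversion e as [| |c' d' s' u1 u2 U1 U2 ec ed| | | |]; subst.
  by case: (IH1 _ _ ec) => ? ?; subst; case: (IH2 _ _ ed) => ? ?; subst.
- move=> t c d s s1 T ht _ IH s3 T3 e.
  inversion e as [| | |? ? ? ? ? ? _ ec|? ? ? ? ? ? hf _| |]; subst.
    by case: (IH _ _ ec) => ? ?; subst.
  by rewrite ht in hf.
- move=> t c d s s1 T hf _ IH s3 T3 e.
  inversion e as [| | |? ? ? ? ? ? ht _|? ? ? ? ? ? _ ed| |]; subst.
    by rewrite ht in hf.
  by case: (IH _ _ ed) => ? ?; subst.
- move=> t c s s1 s2 T1 T2 ht _ IH1 _ IH2 s3 T3 e.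
  inversion e as [| | | | |? ? ? ? ? ? ? _ ec ew|? ? ? hf]; subst.
    by case: (IH1 _ _ ec) => ? ?; subst; case: (IH2 _ _ ew) => ? ?; subst.
  by rewrite ht in hf.
- move=> t c s hf s3 T3 e.
  inversion e as [| | | | |? ? ? ? ? ? ? ht _ _|]; subst => //.
  by rewrite ht in hf.
Qed.

Definition array_of n (x : 'I_n.+1 -> R) : nat -> R :=
  fun k => if insub k is Some i then x i else 0.

(* Index register 0 holds S, real registers 0 and 1 hold beta and delta, and  *)
(* arrays 0 and 1 hold pbar and b; everything else is 0.  The parameter omega *)
(* of the running time bound is not part of the input.                        *)
Definition input_state n (pbar b : 'I_n.+1 -> R) (beta delta : R) : state :=
  State (fun r => if r is 0 then beta else if r is 1 then delta else 0)
        (fun i => if i is 0 then n.+1 else 0)%N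
        (fun a => if a is 0 then array_of pbar
                  else if a is 1 then array_of b else fun=> 0).

(* c outputs the pair (dlo, dhi) in real registers 0 and 1 in time T. *)
Definition computes (c : prog) n (pbar b : 'I_n.+1 -> R) (beta delta : R)
    (dlo dhi : R) (T : nat) : Prop :=
  exists2 s, exec c (input_state pbar b beta delta) s T &
             rreg s 0 = dlo /\ rreg s 1 = dhi.

End Semantics.

(* Main.v *)
(* The tilted distributions p_a(i) ~ pbar i * exp (- a * b i), a >= 0, attain *)
(* equality in the Fenchel-Young bound                                        *)
(* dual_fun a = - a * beta - ln (partition_sum a) <= divKL pbar p,            *)
(* so the value of the problem is dual_fun a at any zero a of excess, the     *)
(* mean of b - beta under p_a up to normalization.  It is positive at 0, and  *)
(* nonpositive at - ln (minv pbar) / (beta - minv b), where the dual          *)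
(* objective is already <= 0.  Bisecting the sign of excess therefore         *)
(* brackets a zero; dual_fun increases with slope at most maxv b, so a        *)
(* bracket of width delta / maxv b suffices.  Halving the initial bracket to  *)
(* that width takes log2 (maxv b * ln (minv pbar)^-1 / (delta * omega))       *)
(* evaluations of excess, each costing O(S) operations.                       *)
Require Import Defs.
From mathcomp Require Import all_boot all_order all_algebra.
From mathcomp Require Import all_classical all_reals all_analysis.
From mathcomp Require Import ring lra zify.

Set Implicit Arguments.
Unset Strict Implicit.
Unset Printing Implicit Defensive.

Import Order.TTheory GRing.Theory Num.Theory.
Import numFieldNormedType.Exports.
Local Open Scope ring_scope.

(** Lagrangian duality reduces the projection to a scalar root search: [weak_duality] bounds the
    minimum from below by [dual_fun], with equality at a zero of [excess] ([projection_value_dual]).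
    [excess_le0] supplies a computable right end for the search, and [delta_solution_bracket] turns
    a short bracket into an answer of accuracy [delta]. On the machine side, [runs] is a timed Hoare
    logic with [bracket] as loop invariant; [initial_width_le] and [iteration_bound] limit the
    halvings, and [runs_bisection] adds up the costs. *)

(** * Lagrangian duality for the Kullback-Leibler projection *)

Section Duality.
Variables (R : realType) (n : nat) (pbar b : 'I_n.+1 -> R) (beta : R).
Implicit Types (a t u : R) (p : 'I_n.+1 -> R).

Definition partition_sum a : R := \sum_i pbar i * expR (- (a * b i)).

Definition excess a : R := \sum_i pbar i * expR (- (a * b i)) * (b i - beta).

Definition dual_fun a : R := - (a * beta) - ln (partition_sum a).

Definition tilted a i : R := pbar i * expR (- (a * b i)) / partition_sum a.

(** For [t > 0], multiply [1 + x <= expR x] at [x = u - ln t] by [t]. *)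
Lemma phiKL_ge t u : 0 <= t -> t * u - expR u + 1 <= phiKL t.
Proof.
rewrite le_eqVlt /phiKL => /predU1P[<-|t_gt0].
  by rewrite !mul0r; have := expR_ge0 u; lra.
have := expR_ge1Dx (u - ln t); rewrite expRD expRN lnK// => h.
have : t * (1 + (u - ln t)) <= expR u.
  by rewrite -ler_pdivlMl // mulrC.
lra.
Qed.

Lemma phiKL_expR u : phiKL (expR u) = expR u * u - expR u + 1.
Proof. by rewrite /phiKL expRK. Qed.

Hypotheses (pbar_simplex : simplex pbar) (pbar_gt0 : forall i, 0 < pbar i).

Lemma partition_sum_gt0 a : 0 < partition_sum a.
Proof.
rewrite /partition_sum (bigD1 ord0)//= ltr_pwDl ?mulr_gt0 ?expR_gt0//.
by apply: sumr_ge0 => i _; rewrite mulr_ge0 ?expR_ge0 ?ltW.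
Qed.

Lemma simplex_tilted a : simplex (tilted a).
Proof.
split=> [i|]; last by rewrite -mulr_suml divff ?gt_eqF ?partition_sum_gt0.
by rewrite !mulr_ge0 ?expR_ge0 ?invr_ge0 ?ltW ?partition_sum_gt0.
Qed.

Lemma dotv_tilted a : dotv b (tilted a) - beta = excess a / partition_sum a.
Proof.
have [_ sum1] := simplex_tilted a.
rewrite -[X in _ - X]mulr1 -sum1 mulr_sumr -sumrB /excess mulr_suml.
by apply: eq_bigr => i _; rewrite /tilted; ring.
Qed.

(** The log-density of [tilted a] with respect to [pbar]: the [u] at which Fenchel-Young is an
    equality for [tilted a]. *)
Let expo a i : R := - (a * b i) - ln (partition_sum a).

Let tilted_expo a i : tilted a i = pbar i * expR (expo a i).
Proof.
by rewrite /expo expRD [expR (- ln _)]expRN lnK ?posrE ?partition_sum_gt0// mulrA.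
Qed.

Let sum_expo a p : simplex p ->
  \sum_i (p i * expo a i - tilted a i + pbar i) =
    - (a * dotv b p) - ln (partition_sum a).
Proof.
move=> [_ p1]; have [_ t1] := simplex_tilted a; have [_ pb1] := pbar_simplex.
rewrite big_split sumrB/= t1 pb1 subrK.
transitivity (- (a * dotv b p) - \sum_i p i * ln (partition_sum a)).
  rewrite /dotv mulr_sumr -sumrN -sumrB.
  by apply: eq_bigr => i _; rewrite /expo; ring.
by rewrite -mulr_suml p1 mul1r.
Qed.

(* The Fenchel-Young inequality t * u <= phiKL t + expR u - 1, applied        *)
(* termwise with u = - a * b i - ln (partition_sum a).                        *)
Lemma divKL_ge a p : simplex p ->
  - (a * dotv b p) - ln (partition_sum a) <= divKL pbar p.
Proof.
move=> sp; rewrite -sum_expo//; apply: ler_sum => i _.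
rewrite tilted_expo -[leLHS](_ : pbar i *
  (p i / pbar i * expo a i - expR (expo a i) + 1) = _); last first.
  by field; rewrite gt_eqF.
by rewrite ler_pM2l// phiKL_ge// divr_ge0 ?(ltW (pbar_gt0 _))//; case: sp.
Qed.

Lemma divKL_tilted a :
  divKL pbar (tilted a) = - (a * dotv b (tilted a)) - ln (partition_sum a).
Proof.
rewrite -sum_expo; last exact: simplex_tilted.
apply: eq_bigr => i _; rewrite tilted_expo mulrAC divff ?gt_eqF// mul1r.
by rewrite phiKL_expR; ring.
Qed.

Lemma weak_duality a p :
  0 <= a -> feasible b beta p -> dual_fun a <= divKL pbar p.
Proof.
move=> a_ge0 [bp sp]; apply: le_trans (divKL_ge a sp).
by rewrite lerD2r lerN2 ler_wpM2l.
Qed.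

(** Complementary slackness: at a zero of [excess], [tilted a] meets the constraint with equality,
    so its divergence attains the dual bound. *)
Lemma projection_value_dual a :
  0 <= a -> excess a = 0 -> projection_value pbar b beta (dual_fun a).
Proof.
move=> a_ge0 Ga.
have bt : dotv b (tilted a) = beta.
  by apply/eqP; rewrite -subr_eq0 dotv_tilted Ga mul0r.
split=> [|_ [p fp <-]]; last exact: weak_duality.
exists (tilted a); first by split; [rewrite bt | exact: simplex_tilted].
by rewrite divKL_tilted bt.
Qed.

Lemma excess0 : excess 0 = dotv b pbar - beta.
Proof.
rewrite -[X in _ - X]mulr1 -pbar_simplex.2 mulr_sumr -sumrB.
by apply: eq_bigr => i _; rewrite mul0r oppr0 expR0; ring.
Qed.

(* A positive excess at a gives 0 <= divKL pbar (tilted a) < dual_fun a,      *)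
(* whereas the j-th term of partition_sum already forces dual_fun a <= 0.     *)
Lemma excess_le0 a j :
  0 < a -> - ln (pbar j) <= a * (beta - b j) -> excess a <= 0.
Proof.
move=> a_gt0 ale; rewrite leNgt; apply/negP => Ga.
have bt : beta < dotv b (tilted a).
  by rewrite -subr_gt0 dotv_tilted divr_gt0 ?partition_sum_gt0.
(* Nonnegativity of the divergence is [divKL_ge] at multiplier 0. *)
have d0 : 0 <= divKL pbar (tilted a).
  apply: le_trans (divKL_ge 0 (simplex_tilted a)).
  suff -> : partition_sum 0 = 1 by rewrite ln1 mul0r oppr0 addr0.
  rewrite -pbar_simplex.2; apply: eq_bigr => i _.
  by rewrite mul0r oppr0 expR0 mulr1.
have Zj : ln (pbar j) - a * b j <= ln (partition_sum a).
  rewrite -[X in _ - X]expRK -lnV ?posrE ?expR_gt0//.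
  rewrite -lnM ?posrE ?invr_gt0 ?expR_gt0//.
  rewrite ler_ln ?posrE ?mulr_gt0 ?invr_gt0 ?expR_gt0 ?partition_sum_gt0//.
  rewrite -expRN /partition_sum (bigD1 j)//= lerDl.
  by apply: sumr_ge0 => i _; rewrite mulr_ge0 ?expR_ge0 ?ltW.
move: d0; rewrite divKL_tilted; apply/negP; rewrite -ltNge.
have : a * beta < a * dotv b (tilted a) by rewrite ltr_pM2l.
move: ale; rewrite mulrBr; lra.
Qed.

(** From [a] to [a'] each term of [partition_sum] shrinks at most by the factor
    [expR (- ((a' - a) * M))], and [- (a * beta)] can only decrease. *)
Lemma dual_lipschitz a a' M : 0 <= beta -> (forall i, b i <= M) ->
  a <= a' -> dual_fun a' <= dual_fun a + (a' - a) * M.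
Proof.
move=> beta_ge0 bM aa'.
have : ln (partition_sum a) <= (a' - a) * M + ln (partition_sum a').
  rewrite -[X in X + _]expRK -lnM ?posrE ?expR_gt0 ?partition_sum_gt0//.
  rewrite ler_ln ?posrE ?mulr_gt0 ?expR_gt0 ?partition_sum_gt0//.
  rewrite mulr_sumr; apply: ler_sum => i _; rewrite mulrCA -expRD.
  rewrite ler_pM2l// ler_expR.
  have : (a' - a) * b i <= (a' - a) * M by rewrite ler_wpM2l ?subr_ge0.
  lra.
have : a * beta <= a' * beta by rewrite ler_wpM2r.
rewrite /dual_fun; lra.
Qed.

Lemma excess_root a a' : a <= a' -> 0 < excess a -> excess a' <= 0 ->
  exists2 c, a <= c <= a' & excess c = 0.
Proof.
move=> aa' Ga Ga'.
have [| |c cab Gc] := IVT (f := excess) (v := 0) aa'.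
- apply: continuous_subspaceT => x.
  apply: cvg_big => [|i _]; first exact: add_continuous.
  apply: cvgM; last exact: cvg_cst.
  apply: cvgM; first exact: cvg_cst.
  apply: (@cvg_comp _ _ _ (fun y => - (y * b i)) expR _ _ _ _
    (@continuous_expR R _)).
  by apply: cvgN; apply: cvgM; [exact: cvg_id | exact: cvg_cst].
- by rewrite ge_min Ga' orbT le_max ltW.
- by exists c => //; move: cab; rewrite in_itv.
Qed.

(** The bracket contains a root [c]; weak duality at [a] gives the lower end, the slope bound on
    [[a, c]] the upper one. *)
Lemma delta_solution_bracket a a' M delta :
  0 <= beta -> (forall i, b i <= M) -> 0 <= a <= a' ->
  0 < excess a -> excess a' <= 0 -> 0 <= M -> (a' - a) * M <= delta ->
  delta_solution pbar b beta delta (dual_fun a) (dual_fun a + delta).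
Proof.
move=> beta_ge0 bM /andP[a_ge0 aa'] Ga Ga' M_ge0 aM.
split; last by rewrite addrC addKr.
have [c /andP[ac ca'] Gc] := excess_root aa' Ga Ga'.
have c_ge0 := le_trans a_ge0 ac.
have pc := projection_value_dual c_ge0 Gc.
exists (dual_fun c) => //; apply/andP; split.
  by have [[p fp <-] _] := pc; exact: weak_duality.
apply: le_trans (dual_lipschitz beta_ge0 bM ac) _.
rewrite lerD2l; apply: le_trans aM; rewrite ler_wpM2r// lerD2r//.
Qed.

(** If [j] were the only index, the mean of [b] would be [b j <= beta]. Ensures a positive initial
    width. *)
Lemma pbar_argmin_lt1 j : beta < dotv b pbar -> b j <= beta -> pbar j < 1.
Proof.
move=> bp bj; have [pge0 p1] := pbar_simplex.
suff [i ij] : exists i, i != j.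
  rewrite -p1 (bigD1 j)//= (bigD1 i)//= ltrDl ltr_pwDl//.
  by apply: sumr_ge0.
apply/existsP; apply: contraTT bp => /existsPn h; rewrite -leNgt.
rewrite -[leRHS]mulr1 -p1 mulr_sumr; apply: ler_sum => i _.
by rewrite ler_wpM2r//; have := h i; rewrite negbK => /eqP ->.
Qed.

End Duality.

(** Since [expR 2^-1 <= 2], any [k >= 2 * M] works; rounding up adds at most [1 <= M]. *)
Lemma iteration_bound (R : realType) (X M : R) : 1 <= M -> ln X <= M ->
  exists2 k : nat, X <= 2 ^+ k & k%:R <= 3 * M.
Proof.
move=> M1 XM; exists (Num.truncn (2 * M)).+1; last first.
  have : (Num.truncn (2 * M))%:R <= 2 * M by rewrite truncn_le; lra.
  by rewrite -natr1; lra.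
have [X0|X_gt0] := leP X 0; first by apply: le_trans X0 _; rewrite exprn_ge0.
rewrite -[X]lnK ?posrE//.
have two : expR 2^-1 <= 2 :> R.
  have := expR_ge1Dx (- 2^-1 : R); rewrite expRN => h.
  rewrite -[expR _]invrK -[leRHS]invrK.
  by rewrite lef_pV2 ?posrE ?invr_gt0 ?expR_gt0//; lra.
apply: (@le_trans _ _ (expR 2^-1 ^+ (Num.truncn (2 * M)).+1)); last first.
  by rewrite lerXn2r ?nnegrE ?expR_ge0.
rewrite -expRM_natl ler_expR; apply: le_trans XM _.
have := truncnS_gt (2 * M); lra.
Qed.

(** * Timed Hoare logic for the machine *)

Section TimedRuns.
Variable R : realType.
Implicit Types (s : state R) (c d : prog) (Q : state R -> Prop).

(** Total correctness with an upper bound on time, so that branches of unequal cost share one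
    bound. *)
Definition runs c s (t : nat) Q : Prop :=
  exists s' T, [/\ exec c s s' T, (T <= t)%N & Q s'].

Lemma runs_le c s t t' Q Q' :
  (t <= t')%N -> (forall s', Q s' -> Q' s') -> runs c s t Q -> runs c s t' Q'.
Proof.
move=> tt' QQ' [s' [T [e Tt Qs']]]; exists s', T; split=> //; last exact: QQ'.
exact: leq_trans tt'.
Qed.

Lemma runs_seq c d s t u Q :
  runs c s t (fun s' => runs d s' u Q) -> runs (Seq c d) s (t + u) Q.
Proof.
move=> [s1 [T [ec Tt [s2 [U [ed Uu Qs2]]]]]].
by exists s2, (T + U)%N; split=> //; [exact: ExecSeq ec ed|exact: leq_add].
Qed.

Lemma runs_if e c d s t Q :
  (eval_test e s -> runs c s t Q) -> (~~ eval_test e s -> runs d s t Q) ->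
  runs (If e c d) s t.+1 Q.
Proof.
move=> hc hd; have [h|h] := boolP (eval_test e s).
  have [s1 [T [ec Tt Qs1]]] := hc h.
  by exists s1, T.+1; split=> //; exact: ExecIfTrue.
have [s1 [T [ec Tt Qs1]]] := hd h.
by exists s1, T.+1; split=> //; exact: ExecIfFalse.
Qed.

Definition block (l : seq instr) : prog :=
  foldr (fun o => Seq (Instr o)) Skip l.

Lemma runs_nil s Q : Q s -> runs (block [::]) s 0 Q.
Proof. by exists s, 0%N; split=> //; exact: ExecSkip. Qed.

Lemma runs_cons o (l : seq instr) s t Q :
  instr_defined o s -> runs (block l) (exec_instr o s) t Q ->
  runs (block (o :: l)) s t.+1 Q.
Proof.
move=> ho hl; apply: (@runs_seq _ _ _ 1).
by exists (exec_instr o s), 1%N; split=> //; exact: ExecInstr.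
Qed.

(* k bounds the number of iterations that remain. *)
Lemma runs_while e c (P : nat -> state R -> Prop) k s t :
  (forall s, P 0%N s -> ~~ eval_test e s) ->
  (forall k s, P k.+1 s -> eval_test e s -> runs c s t (P k)) ->
  P k s ->
  runs (While e c) s (k * t.+1).+1
    (fun s' => (exists k', P k' s') /\ ~~ eval_test e s').
Proof.
move=> h0 hS; elim: k s => [|k IH] s Ps.
  exists s, 1%N; split=> //; first by apply: ExecWhileFalse; exact: h0.
  by split; [exists 0%N | exact: h0].
have [h|h] := boolP (eval_test e s); last first.
  exists s, 1%N; split=> //; first exact: ExecWhileFalse.
  by split=> //; exists k.+1.
have [s1 [T [ec Tt Ps1]]] := hS _ _ Ps h.
have [s2 [U [ew Uu Qs2]]] := IH _ Ps1.
exists s2, (T + U).+1; split=> //; first exact: ExecWhileTrue ew.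
by rewrite mulSn; lia.
Qed.

(* Index register 0 holds the bound and index register 1 the counter. *)
Lemma runs_for c (P : nat -> state R -> Prop) N s t :
  (forall k s, P k s -> ireg s 0 = N /\ ireg s 1 = k) ->
  (forall k s, (k < N)%N -> P k s -> runs c s t (P k.+1)) ->
  P 0%N s ->
  runs (While (ILt 1 0) c) s (N * t.+1).+1 (P N).
Proof.
move=> hP hS P0.
(* [runs_while] counts remaining iterations, so the counter is read backwards. *)
pose P' k s' := (k <= N)%N /\ P (N - k)%N s'.
have [||| s' [T [e Tt [[k [kN Pk]] h]]]] :=
  @runs_while (ILt 1 0) c P' N s t.
- by move=> s' [_]; rewrite subn0 => /hP[/= -> ->]; rewrite ltnn.
- move=> k s' [kN Ps'] _.
  apply: (runs_le (leqnn t)); last by apply: hS Ps'; lia.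
  by move=> s'' Ps''; split; [lia | rewrite subnSK in Ps''].
- by split=> //; rewrite subnn.
exists s', T; split=> //; suff -> : N = (N - k)%N by [].
by move: h => /=; have [-> ->] := hP _ _ Pk; lia.
Qed.

End TimedRuns.
Arguments block : simpl never.

(** * The bisection program *)

Definition eval_step : prog := block
  [:: RLoad 12 0 1; RLoad 13 1 1; RMul 14 9 13; RConst 15 0; RSub 14 15 14;
      RExp 14 14; RMul 12 12 14; RAdd 10 10 12; RSub 13 13 0; RMul 12 12 13;
      RAdd 11 11 12; ISucc 1].

Definition eval_dual : prog :=
  Seq (block [:: RConst 10 0; RConst 11 0; IConst 1 0])
      (While (ILt 1 0) eval_step).

Definition select (u v r w : nat) : prog :=
  If (RLt u v) (block [:: RCopy r w]) Skip.

Definition extrema_step : prog :=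
  Seq (block [:: RLoad 12 0 1; RLoad 13 1 1])
 (Seq (select 12 2 2 12)
 (Seq (select 13 3 3 13)
 (Seq (select 4 13 4 13)
      (block [:: ISucc 1])))).

Definition extrema : prog :=
  Seq (block [:: RLoad 2 0 1; RLoad 3 1 1; RCopy 4 3])
      (While (ILt 1 0) extrema_step).

(** The gap [beta - minv b], at least [omega], is computed from the input and stands in for
    [omega]. *)
Definition bisect_init : prog :=
  block [:: RConst 5 0; RLog 6 2; RSub 6 5 6; RSub 7 0 3; RDiv 6 6 7;
            RMul 7 6 4].

Definition bisect_step : prog :=
  Seq (block [:: RConst 8 2; RDiv 6 6 8; RMul 7 6 4; RAdd 9 5 6])
 (Seq eval_dual
 (Seq (block [:: RConst 8 0])
      (select 8 11 5 9))).

Definition output : prog :=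
  Seq (block [:: RCopy 9 5])
 (Seq eval_dual
      (block [:: RLog 10 10; RMul 9 9 0; RConst 8 0; RSub 9 8 9; RSub 0 9 10;
                 RAdd 1 0 1])).

(* Real registers: 2 holds minv pbar, 3 and 4 hold minv b and maxv b, 5 the   *)
(* lower end of the bracket, 6 its width, 7 the width times maxv b, 9 the     *)
(* point at which eval_dual computes partition_sum (in 10) and excess (in 11);*)
(* the others are scratch.                                                    *)
Definition bisection : prog :=
  Seq extrema (Seq bisect_init
 (Seq (While (RLt 1 7) bisect_step) output)).

Ltac run_block :=
  repeat (apply: runs_cons;
    [rewrite /=; try by rewrite ?pnatr_eq0
    |rewrite /= /set_rreg /set_ireg /upd /=]);
  try apply: runs_nil.

(** * Correctness and running time of the program *)

Section Correctness.
Variables (R : realType) (n : nat) (pbar b : 'I_n.+1 -> R) (beta delta : R).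
Implicit Types (s : state R).

Lemma array_ofE (x : 'I_n.+1 -> R) (i : 'I_n.+1) : array_of x i = x i.
Proof. by rewrite /array_of valK. Qed.

Lemma runs_select u v r w s (Q : state R -> Prop) :
  Q (set_rreg s r (if rreg s u < rreg s v then rreg s w else rreg s r)) ->
  runs (select u v r w) s 2 Q.
Proof.
move=> hQ; apply: runs_if => /= [uv|/negbTE uv]; rewrite uv in hQ.
  by apply: runs_cons => //; exact: runs_nil.
exists s, 0%N; split=> //; first exact: ExecSkip.
suff <- : set_rreg s r (rreg s r) = s by [].
case: s {uv hQ} => f g h; congr State; apply/funext => j.
by rewrite /upd /=; case: eqP => // ->.
Qed.

Definition input_data s : Prop :=
  [/\ rreg s 0 = beta, rreg s 1 = delta, ireg s 0 = n.+1,
      arr s 0 = array_of pbar & arr s 1 = array_of b].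

(** A pass costs 12 instructions and one test. Registers below 10 carry the state of the search. *)
Lemma runs_eval_dual s : input_data s ->
  runs eval_dual s (3 + (n.+1 * 13).+1) (fun s' =>
    [/\ input_data s', forall r, (r < 10)%N -> rreg s' r = rreg s r,
        rreg s' 10 = partition_sum pbar b (rreg s 9) &
        rreg s' 11 = excess pbar b beta (rreg s 9)]).
Proof.
move=> [s0 s1 i0 a0 a1]; set a := rreg s 9.
pose sumZ k : R := \sum_(0 <= j < k)
  array_of pbar j * expR (- (a * array_of b j)).
pose sumG k : R := \sum_(0 <= j < k)
  array_of pbar j * expR (- (a * array_of b j)) * (array_of b j - beta).
pose P k s' := [/\ input_data s', forall r, (r < 10)%N -> rreg s' r = rreg s r,
  ireg s' 1 = k, rreg s' 10 = sumZ k & rreg s' 11 = sumG k].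
apply: runs_seq; run_block.
apply: (runs_le (leqnn _)); last apply: (@runs_for _ _ P).
- move=> s' [ds' keep _ -> ->]; split=> //; rewrite /sumZ /sumG big_mkord;
  by apply: eq_bigr => i _; rewrite !array_ofE.
- by move=> k s' [[]].
- move=> k s' kn [[s0' s1' i0' a0' a1'] keep i1' Zk Gk].
  run_block.
  split=> //=.
  + move=> r r10; rewrite /upd /= -keep//.
    by do ?case: eqP => [e|_]; first [by rewrite e in r10|idtac].
  + by rewrite i1'.
  + by rewrite /sumZ big_nat_recr//= Zk a0' a1' i1' keep// sub0r.
  + by rewrite /sumG big_nat_recr//= Gk a0' a1' i1' keep// s0' sub0r.
- split=> //=.
  + move=> r r10; rewrite /upd /=.
    by do ?case: eqP => [e|_]; first [by rewrite e in r10|idtac].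
  + by rewrite /sumZ big_geq.
  + by rewrite /sumG big_geq.
Qed.

Lemma runs_extrema s : input_data s -> ireg s 1 = 0%N ->
  runs extrema s (3 + (n.+1 * 10).+1) (fun s' =>
    [/\ input_data s',
        (exists j, rreg s' 2 = pbar j) /\ (forall i, rreg s' 2 <= pbar i),
        (exists j, rreg s' 3 = b j) /\ (forall i, rreg s' 3 <= b i) &
        (exists j, rreg s' 4 = b j) /\ (forall i, b i <= rreg s' 4)]).
Proof.
move=> [s0 s1 i0 a0 a1] i1.
pose P k s' := [/\ input_data s', ireg s' 1 = k,
  (exists j, rreg s' 2 = pbar j) /\
    (forall i : 'I_n.+1, (i < k)%N -> rreg s' 2 <= pbar i),
  (exists j, rreg s' 3 = b j) /\
    (forall i : 'I_n.+1, (i < k)%N -> rreg s' 3 <= b i) &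
  (exists j, rreg s' 4 = b j) /\
    (forall i : 'I_n.+1, (i < k)%N -> b i <= rreg s' 4)].
apply: runs_seq; run_block.
apply: (runs_le (leqnn _)); last apply: (@runs_for _ _ P).
- move=> s' [ds' _ [e2 l2] [e3 l3] [e4 l4]].
  by split=> //; split=> // i; [apply: l2|apply: l3|apply: l4].
- by move=> k s' [[]].
- move=> k s' kn [[s0' s1' i0' a0' a1'] i1' [e2 l2] [e3 l3] [e4 l4]].
  apply: (@runs_seq _ _ _ _ 2 7).
  run_block.
  apply: (@runs_seq _ _ _ _ 2 5); apply: runs_select.
  rewrite /set_rreg /upd /=.
  apply: (@runs_seq _ _ _ _ 2 3); apply: runs_select.
  rewrite /set_rreg /upd /=.
  apply: (@runs_seq _ _ _ _ 2 1); apply: runs_select.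
  rewrite /set_rreg /upd /=.
  run_block.
  have ik (i : 'I_n.+1) : (i < k.+1)%N -> (i < k)%N \/ i = Ordinal kn.
    rewrite ltnS leq_eqVlt => /predU1P[ik|]; [right|left] => //.
    exact: val_inj.
  split=> //=.
  + by rewrite i1'.
  + rewrite a0' i1' (array_ofE pbar (Ordinal kn)); case: e2 => j e2.
    split; first by case: ifP => _; [exists (Ordinal kn)|exists j].
    move=> i /ik; rewrite -/(Num.min _ _) ge_min => -[/l2 ->|->];
    by rewrite ?lexx ?orbT.
  + rewrite a1' i1' (array_ofE b (Ordinal kn)); case: e3 => j e3.
    split; first by case: ifP => _; [exists (Ordinal kn)|exists j].
    move=> i /ik; rewrite -/(Num.min _ _) ge_min => -[/l3 ->|->];
    by rewrite ?lexx ?orbT.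
  + rewrite a1' i1' (array_ofE b (Ordinal kn)); case: e4 => j e4.
    split; first by case: ifP => _; [exists (Ordinal kn)|exists j].
    move=> i /ik; rewrite -/(Num.max _ _) le_max => -[/l4 ->|->];
    by rewrite ?lexx ?orbT.
- split=> //=.
  all: by split=> //; exists ord0; rewrite ?a0 ?a1 ?i1 // -array_ofE.
Qed.

Hypotheses (pbar_simplex : simplex pbar) (pbar_gt0 : forall i, 0 < pbar i).
Hypotheses (beta_ge0 : 0 <= beta) (b_ge0 : forall i, 0 <= b i).
Hypothesis (beta_lt : beta < dotv b pbar).

(* k halvings bring the width of the bracket down to delta / mx. *)
Definition bracket (mx : R) (k : nat) s : Prop := input_data s /\
  exists lo w,
    [/\ rreg s 4 = mx, rreg s 5 = lo, rreg s 6 = w & rreg s 7 = w * mx] /\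
    [/\ 0 <= lo, 0 <= w, 0 < excess pbar b beta lo,
        excess pbar b beta (lo + w) <= 0 & w * mx <= delta * 2 ^+ k].

Lemma runs_bisect_step mx k s : bracket mx k.+1 s ->
  runs bisect_step s (n.+1 * 13 + 11) (bracket mx k).
Proof.
move=> [[s0 s1 i0 a0 a1] [lo [w [[s4 s5 s6 s7] [lo0 w0 Glo Ghi wk]]]]].
have -> : (n.+1 * 13 + 11 = 4 + (3 + (n.+1 * 13).+1 + (1 + 2)))%N by lia.
apply: runs_seq; run_block.
apply: runs_seq; apply: (runs_le (leqnn _)); last exact: runs_eval_dual.
move=> s' [[s0' s1' i0' a0' a1'] keep _ G'].
apply: runs_seq; run_block; apply: runs_select; rewrite /set_rreg /upd /=.
rewrite G' /= !keep //= ?s4 ?s5 ?s6.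
split=> //; have wk2 : w / 2 * mx <= delta * 2 ^+ k.
  by move: wk; rewrite exprS; lra.
(* When the left end moves to the midpoint, the right end stays in place. *)
have lw : lo + w / 2 + w / 2 = lo + w by lra.
case: ltP => G; [exists (lo + w / 2), (w / 2)|exists lo, (w / 2)].
  by split; split=> //=; rewrite ?keep//= ?s4 ?s6 ?lw//; lra.
by split; split=> //=; rewrite ?keep//= ?s4 ?s5 ?s6 ?lw//; lra.
Qed.

Variable (omega : R).
Hypotheses (omega_gt0 : 0 < omega) (minb_le : minv b + omega <= beta).
Hypothesis (delta_gt0 : 0 < delta).

(** Factorwise comparison, with [omega <= beta - b j]; this is how [omega] enters the running
    time. *)
Lemma initial_width_le i j k : (forall l, b j <= b l) ->
  - ln (pbar i) / (beta - b j) * b k <=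
  maxv b * ln (minv pbar)^-1 / omega.
Proof.
move=> bj.
have omega_le : omega <= beta - b j.
  have : b j <= minv b by apply: le_bigmin.
  by move: minb_le; lra.
have minp_gt0 : 0 < minv pbar by apply/bigmin_gtP.
have pi1 : pbar i <= 1.
  rewrite -pbar_simplex.2 (bigD1 i)//= lerDl.
  by apply: sumr_ge0 => l _; exact: ltW.
have lnp0 : 0 <= - ln (pbar i) by rewrite oppr_ge0 ln_le0.
rewrite mulrC mulrA; apply: ler_pM.
- by rewrite mulr_ge0.
- by rewrite invr_ge0; exact: ltW (lt_le_trans omega_gt0 omega_le).
- apply: ler_pM => //; first exact: le_bigmax.
  by rewrite lnV ?posrE// lerN2 ler_ln ?posrE// bigmin_le.
- by rewrite lef_pV2// posrE; exact: lt_le_trans omega_le.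
Qed.

Lemma runs_bisect_init K s : input_data s ->
  (exists j, rreg s 2 = pbar j) /\ (forall i, rreg s 2 <= pbar i) ->
  (exists j, rreg s 3 = b j) /\ (forall i, rreg s 3 <= b i) ->
  (exists j, rreg s 4 = b j) ->
  maxv b * ln (minv pbar)^-1 / (delta * omega) <= 2 ^+ K ->
  runs bisect_init s 6 (fun s' => bracket (rreg s 4) K s').
Proof.
move=> [s0 s1 i0 a0 a1] [[i s2] p_ge] [[j s3] b_ge] [k s4] XK.
have bj l : b j <= b l by rewrite -s3.
have pij : pbar i <= pbar j by rewrite -s2.
have bjbeta : b j < beta.
  have : b j <= minv b by apply: le_bigmin.
  by move: minb_le omega_gt0; lra.
have pj1 : pbar j < 1.
  by apply: (pbar_argmin_lt1 pbar_simplex pbar_gt0 beta_lt); exact: ltW.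
run_block.
- by rewrite s2.
- by rewrite s0 s3 subr_eq0 gt_eqF.
rewrite s0 s2 s3 s4 sub0r; split=> //=; set w := - ln (pbar i) / (beta - b j).
have w_gt0 : 0 < w.
  by rewrite divr_gt0 ?subr_gt0// oppr_gt0 ln_lt0// pbar_gt0 (le_lt_trans pij).
exists 0, w; split=> //; split=> //.
- exact: ltW.
- by rewrite excess0// subr_gt0.
(* Here [j] minimizes [b] and [i] minimizes [pbar], so [- ln (pbar i)] dominates the [- ln (pbar j)]
   that [excess_le0] asks for. *)
- rewrite add0r; apply: (excess_le0 pbar_simplex pbar_gt0 (j := j)) => //.
  by rewrite /w divfK ?subr_eq0 ?gt_eqF// lerN2 ler_ln ?posrE.
- apply: le_trans (initial_width_le i k bj) _.
  rewrite [leRHS]mulrC -ler_pdivrMr//.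
  by move: XK; rewrite invfM mulrA [X in X <= _]mulrAC.
Qed.

Lemma runs_output s lo : input_data s -> rreg s 5 = lo ->
  runs output s (n.+1 * 13 + 11) (fun s' =>
    rreg s' 0 = dual_fun pbar b beta lo /\
    rreg s' 1 = dual_fun pbar b beta lo + delta).
Proof.
move=> [s0 s1 i0 a0 a1] s5.
have -> : (n.+1 * 13 + 11 = 1 + (3 + (n.+1 * 13).+1 + 6))%N by lia.
apply: runs_seq; run_block.
apply: runs_seq; apply: (runs_le (leqnn _)); last exact: runs_eval_dual.
move=> s' [[s0' s1' i0' a0' a1'] keep Z' _].
run_block; first by rewrite Z' partition_sum_gt0.
by rewrite Z' s0' s1' keep//= s5 sub0r.
Qed.

(** Leaving the loop means that the width times the largest entry of [b] is at most [delta]; [K]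
    serves to bound the time and is unknown to the program. *)
Lemma runs_bisection K s : input_data s -> ireg s 1 = 0%N ->
  maxv b * ln (minv pbar)^-1 / (delta * omega) <= 2 ^+ K ->
  runs bisection s (100 * n.+1 * K.+1) (fun s' =>
    delta_solution pbar b beta delta (rreg s' 0) (rreg s' 1)).
Proof.
move=> ds i1 XK.
pose A := (3 + (n.+1 * 10).+1)%N; pose B := (n.+1 * 13 + 11)%N.
apply: (@runs_le _ _ _ (A + (6 + ((K * B.+1).+1 + B)))).
- by rewrite /A /B; nia.
- by move=> s' Qs'; exact: Qs'.
apply: runs_seq; apply: (runs_le (leqnn _)); last exact: runs_extrema.
move=> s1 [ds1 e2 e3 [e4 b_le]].
apply: runs_seq; apply: (runs_le (leqnn _)); last exact: runs_bisect_init XK.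
move=> s2 br; apply: runs_seq.
apply: (runs_le (leqnn _));
  last apply: (runs_while (P := bracket (rreg s1 4))) br.
- move=> s3 [[k [ds3 [lo [w [[r4 r5 r6 r7] [lo0 w0 Glo Ghi _]]]]]] /=].
  have [_ r1 _ _ _] := ds3; rewrite r1 r7 -leNgt => wM.
  apply: (runs_le (leqnn _)); last exact: runs_output ds3 r5.
  move=> s4 [-> ->].
  apply: (@delta_solution_bracket _ _ _ _ _ pbar_simplex pbar_gt0
    lo (lo + w) (rreg s1 4)) => //.
  + by rewrite lo0 lerDl.
  + by case: e4 => j ->.
  + by rewrite addrC addKr.
- move=> s3 [[_ r1 _ _ _] [lo [w [[_ _ _ r7] [_ _ _ _]]]]] /=.
  by rewrite expr0 mulr1 r1 r7 -leNgt.
- by move=> k s3 br3 _; exact: runs_bisect_step.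
Qed.

End Correctness.

Theorem theorem2 (R : realType) :
  exists (c : prog) (C : R),
    forall (n : nat) (pbar b : 'I_n.+1 -> R) (beta omega delta : R),
      simplex pbar -> (forall i, 0 < pbar i) ->
      (forall i, 0 <= b i) -> 0 <= beta -> beta < dotv b pbar ->
      0 < omega -> minv b + omega <= beta -> 0 < delta ->
      exists (dlo dhi : R) (T : nat),
        [/\ computes c pbar b beta delta dlo dhi T,
            delta_solution pbar b beta delta dlo dhi &
            T%:R <= C * (n.+1%:R *
              Num.max 1 (ln (maxv b * ln (minv pbar)^-1 / (delta * omega))))].
Proof.
(* [400 = 100 * 4]: [K <= 3 * M] and [1 <= M] give [K + 1 <= 4 * M]. *)
exists bisection, 400.
move=> n pbar b beta omega delta sp pgt0 bge0 beta_ge0 blt ogt0 minb_le dgt0.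
set X := _ / (delta * omega); set M := Num.max 1 (ln X).
have M1 : 1 <= M by rewrite le_max lexx.
have [K XK KM] : exists2 K : nat, X <= 2 ^+ K & K%:R <= 3 * M.
  by apply: iteration_bound => //; rewrite le_max lexx orbT.
have [] := @runs_bisection R n pbar b beta delta sp pgt0 beta_ge0 bge0 blt omega
  ogt0 minb_le dgt0 K (input_state pbar b beta delta) _ erefl XK.
  by [].
move=> s [T [es TK sol]].
exists (rreg s 0), (rreg s 1), T; split=> //; first by exists s.
apply: (@le_trans _ _ (100 * n.+1 * K.+1)%:R); first by rewrite ler_nat.
have : n.+1%:R * K.+1%:R <= n.+1%:R * (4 * M).
  by rewrite ler_wpM2l// -natr1; lra.
rewrite !natrM; lra.
Qed.
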